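(* Consider a random (closed) map $\{T_\omega\}$ and assume the random potential $-\log|T'_\omega|$ is strongly contracting (with $n_*=1$). Furthermore, assume $\Omega$ is a Borel subset of a separable complete metric space, $m$ is a Borel probability measure and $\sigma$ is a homeomorphism. Then $\{T_\omega\}$ is covering: for $m$-a.e. $\omega\in\Omega$ and every open interval $J\subset I$ there exists $M_\omega(J)\in\mathbb N$ such that $\operatorname{Einf}\big(\mathcal L^{(M_\omega(J))}_\omega\mathbf 1_J\big)>0$.
   Context: Functions. $I\subset\mathbb R$ is a compact interval. $\operatorname{Einf}(f)$, $\operatorname{Esup}(f)$ are the essential infimum/supremum of $f$ on $I$ with respect to Lebesgue measure; $\|f\|_\infty=\operatorname{Esup}|f|$; $\operatorname{var}(f)$ is the total variation on $I$. $BV$ is the Banach space of (Lebesgue classes of) functions of bounded variation on $I$, represented by representatives of minimal variation. Random maps. $T_1,T_2,\dots:I\to I$ is a countable collection of maps, each admitting a finite partition of $I$ (mod Lebesgue) on whose atoms it is monotonic and continuous, and each having at least one full branch. The weights are $g_j=1/|T_j'|$, assumed to be of bounded variation. $(\Omega,m)$ is a complete probability space, $\sigma:(\Omega,m)\to(\Omega,m)$ is ergodic, invertible and probability preserving. $\Omega=\bigcup_j\Omega_j$ is an at most countable measurable partition, and for $\omega\in\Omega_j$ set $T_\omega=T_j$, $g_\omega=g_j$. Partitions. $\mathring{\mathcal Z}_\omega$ is the monotonicity partition of $T_\omega$ into intervals (there are no holes). An element $Z\in\mathring{\mathcal Z}_\omega$ is full if $T_\omega(Z)=I$, non-full otherwise.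 $b_{\omega,f}$ is the number of full elements. Non-full elements $Z_1,\dots,Z_k$ are contiguous if the convex hull of their union contains no full element; $\xi^{(1)}_\omega$ is the largest number of contiguous non-full elements. Transfer operator. $\mathcal L_\omega f=\sum_{Z\in\mathring{\mathcal Z}_\omega}\mathbf 1_{T_\omega(Z)}\,\big((fg_\omega)\circ (T_\omega|_Z)^{-1}\big)$ for $f\in BV$, and $\mathcal L^{(n)}_\omega=\mathcal L_{\sigma^{n-1}\omega}\circ\cdots\circ\mathcal L_\omega$. Strongly contracting potential (with $n_*=1$). $\{\log g_\omega\}$ is strongly contracting with $n_*=1$ if $\log\#\mathring{\mathcal Z}_\omega$, $\log\|g_\omega\|_\infty$, $\log\operatorname{Einf}(g_\omega)$, $\frac{\operatorname{var}(g_\omega)}{\|g_\omega\|_\infty}\in L^1(m)$ and $\int\log c_{\omega,1}\,dm<0$, where $$c_{\omega,1}=\Big(3+3\frac{\operatorname{var}(g_\omega)}{\|g_\omega\|_\infty}\Big)(1+2\xi^{(1)}_\omega)\frac{\|g_\omega\|_\infty}{\operatorname{Einf}(g_\omega)}\cdot\frac1{b_{\omega,f}} .$$ *)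

(* Defs.v *)
From HB Require Import structures.
From mathcomp Require Import all_boot all_order all_algebra.
From mathcomp Require Import all_classical all_reals all_analysis.
From mathcomp Require Import ess_sup_inf.

Set Implicit Arguments.
Unset Strict Implicit.
Unset Printing Implicit Defensive.

Import Order.TTheory GRing.Theory Num.Theory.
Import numFieldNormedType.Exports.

Local Open Scope classical_set_scope.
Local Open Scope ring_scope.

Section interval_functions.
Context {R : realType}.
Variables (a b : R).
Implicit Types f : R -> R.

Definition leb_on : {measure set (measurableTypeR R) -> \bar R} :=
  mrestr lebesgue_measure (measurable_itv `[a, b]).

Definition Einf f : \bar R := ess_inf leb_on (EFin \o f).

Definition Esup f : \bar R := ess_sup leb_on (EFin \o f).

Definition norm_infty f : \bar R := Esup (fun x => `|f x|).

(* The variation of the Lebesgue class of [f]: the total variation of a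
   representative of minimal variation. *)
Definition var f : \bar R :=
  ereal_inf [set total_variation a b h |
    h in [set h : R -> R | \forall x \ae leb_on, h x = f x]].

End interval_functions.

(* A map [T] of [a, b] comes with the end points [s] of its monotonicity
   intervals, a = s_(-1) < s_0 < ... < s_(n-1) = b.  Partitions are understood
   modulo Lebesgue null sets, so the atoms are taken to be the open intervals
   between consecutive points, and images are compared with [a, b] modulo null
   sets as well. *)
Section interval_map.
Context {R : realType}.
Variables (a b : R) (T : R -> R) (s : seq R).

Definition atom (i : 'I_(size s)) : set R :=
  `](nth b (a :: s) i), (nth b (a :: s) i.+1)[%classic.

Definition full (i : 'I_(size s)) : Prop :=
  lebesgue_measure (`[a, b]%classic `\` (T @` atom i)) = 0%E.

Definition nb_full : nat := #|[set i | `[< full i >]]%SET|.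

(* On the real line the convex hull is the interval hull [Rhull]. *)
Definition contiguous (A : {set 'I_(size s)}) : Prop :=
  (forall i, i \in A -> ~ full i) /\
  (forall k, full k ->
     ~ (atom k `<=` [set` Rhull (\bigcup_(i in [set` A]) atom i)])).

Definition xi : nat :=
  \max_(A : {set 'I_(size s)} | `[< contiguous A >]) #|A|.

Definition weight (x : R) : R := `|derive1 T x|^-1.

(* The derivative may fail to exist at countably many points inside the atoms
   (a weight of bounded variation may have countably many jumps). *)
Record piecewise_monotone_map : Prop := {
  pm_partition : itv_partition a b s;
  pm_range : {homo T : x / x \in `[a, b]};
  pm_continuous : forall i, {within atom i, continuous T};
  pm_monotone : forall i,
    {in atom i &, {homo T : x y / x <= y}} \/
    {in atom i &, {homo T : x y / x <= y >-> y <= x}};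
  pm_derivable : exists2 N : set R, countable N &
    forall i x, atom i x -> ~ N x -> derivable T x 1 /\ derive1 T x != 0;
  pm_full : exists i, full i;
  pm_weight_bv : (var a b weight < +oo)%E }.

(* ['pinv_] is the inverse branch; it is only meaningful on [T @` atom i], where
   the indicator does not vanish. *)
Definition transfer (f : R -> R) (y : R) : R :=
  \sum_(i < size s)
    \1_(T @` atom i) y * (f \* weight) (pinv (atom i) T y).

(* With the conventions of [inve], the quotients are the usual ones as soon as
   the essential infimum of the weight is positive, which the integrability of
   its logarithm enforces in [strongly_contracting]. *)
Definition contraction_coef : \bar R :=
  let V := var a b weight in
  let M := norm_infty a b weight in
  let e := Einf a b weight in
  ((3%:E + 3%:E * (V / M)) * (1 + 2 * xi)%:R%:E * (M / e)
    * (nb_full%:R%:E)^-1)%E.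

End interval_map.

(* The map used at [w] is [T (idx w)]; the partition of the base space consists
   of the (possibly empty) sets of [w] with [idx w = j]. *)
Section random_map.
Context {R : realType} {d : measure_display} {Omega : measurableType d}.
Variable m : probability Omega R.
Variables (sigma : Omega -> Omega) (idx : Omega -> nat).
Variables (a b : R) (T : nat -> R -> R) (s : nat -> seq R).

Definition transfer_at (w : Omega) : (R -> R) -> R -> R :=
  transfer a b (T (idx w)) (s (idx w)).

Fixpoint transfer_iter (n : nat) (w : Omega) (f : R -> R) : R -> R :=
  if n is n'.+1
  then transfer_at (iter n' sigma w) (transfer_iter n' w f)
  else f.

Definition measurable_index : Prop :=
  forall j : nat, measurable [set w | idx w = j].

Record strongly_contracting : Prop := {
  sc_card : m.-integrable setT (fun w => lne ((size (s (idx w)))%:R%:E));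
  sc_norm : m.-integrable setT
    (fun w => lne (norm_infty a b (weight (T (idx w)))));
  sc_einf : m.-integrable setT
    (fun w => lne (Einf a b (weight (T (idx w)))));
  sc_var : m.-integrable setT
    (fun w => var a b (weight (T (idx w)))
              / norm_infty a b (weight (T (idx w))))%E;
  sc_coef : (\int[m]_w lne (contraction_coef a b (T (idx w)) (s (idx w)))
             < 0)%E }.

Definition covering : Prop :=
  {ae m, forall w, forall c e : R, a <= c -> c < e -> e <= b ->
     exists2 M : nat, (0 < M)%N &
       (0 < Einf a b (transfer_iter M w \1_(`]c, e[%classic)))%E}.

End random_map.

Section base_dynamics.
Context {R : realType} {d : measure_display} {Omega : measurableType d}.
Variables (m : probability Omega R) (sigma tau : Omega -> Omega).

Record invertible_ergodic : Prop := {
  ie_cancel : cancel sigma tau;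
  ie_cancelV : cancel tau sigma;
  ie_measurable : measurable_fun setT sigma;
  ie_measurableV : measurable_fun setT tau;
  ie_preserving : forall A, measurable A -> m (sigma @^-1` A) = m A;
  ie_ergodic : forall A, measurable A -> sigma @^-1` A = A ->
    m A = 0%E \/ m A = 1%E }.

End base_dynamics.

Definition borel {E : topologicalType} : set (set E) := <<s @open E >>.

Definition complete_space (E : uniformType) : Prop :=
  forall F : set_system E, ProperFilter F -> cauchy F -> exists x : E, F --> x.

Definition separable (E : topologicalType) : Prop :=
  exists2 D : set E, countable D & dense D.

Section borel_base.
Context {R : realType} {d : measure_display} {Omega : measurableType d}.
Context {E : metricType R}.
Variables (m : probability Omega R) (iota : Omega -> E).

(* [iota] is the inclusion of [Omega] in [E], and [initial_topology iota] is
   [Omega] with the subspace topology. *)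
Record borel_subset : Prop := {
  bs_inj : injective iota;
  bs_range : borel (range iota) }.

(* A complete probability space whose measure is Borel: the measurable sets are
   the completion of the Borel sets. *)
Record complete_borel_measure : Prop := {
  cb_complete : measure_is_complete m;
  cb_borel : forall B : set (initial_topology iota),
    borel B -> measurable (B : set Omega);
  cb_sandwich : forall A : set Omega, measurable A ->
    exists B C : set (initial_topology iota),
      [/\ borel B, borel C, B `<=` A, A `<=` C & m (C `\` B) = 0%E] }.

Definition homeomorphism (sigma tau : Omega -> Omega) : Prop :=
  continuous (sigma : initial_topology iota -> initial_topology iota) /\
  continuous (tau : initial_topology iota -> initial_topology iota).

End borel_base.

(* Main.v *)
Require Import Defs.
From HB Require Import structures.
From mathcomp Require Import all_boot all_order all_algebra.
From mathcomp Require Import all_classical all_reals all_analysis.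
From mathcomp Require Import ess_sup_inf measurable_realfun ring lra.

Set Implicit Arguments.
Unset Strict Implicit.
Unset Printing Implicit Defensive.

Import Order.TTheory GRing.Theory Num.Theory.
Import numFieldNormedType.Exports.

Local Open Scope classical_set_scope.
Local Open Scope ring_scope.

(** Since the weights have a positive essential infimum, covering says that the
    images of an interval [J] eventually fill [[a, b]] up to a null set.  The
    images are followed through intervals [J_n] on which the [n]-th iterate of
    the indicator of [J] is essentially bounded below.

    If [J_n] contains a full atom, the next image is everything.  Otherwise
    [J_n] meets at most [xi + 2] atoms: those inside it are contiguous non-full
    atoms and the others contain an end point of [J_n] (lemma [large_piece]).
    The longest piece of [J_n] in an atom is stretched by at least the inverse
    of the essential supremum [M] of the weight, so the length of [J_n] is
    divided by at most [3/2 (xi + 2) M], the factor [3/2] leaving room to stay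
    away from the end points of atoms (lemma [cover_or_grow]).  Conversely the
    atoms that are full have length at least [e (b - a)], where [e] is the
    essential infimum of the weight, so [e] times their number is at most [1]
    (lemma [nb_full_bound]) and the contraction coefficient is at least
    [3 (1 + 2 xi) M >= 3/2 (xi + 2) M].  Hence the lengths grow at least like
    the inverse of the product of the contraction coefficients along the orbit,
    and a full atom is met once one of these products is small enough.

    The logarithm of the contraction coefficient is integrable with a negative
    mean, so its Birkhoff sums are almost surely unbounded below (lemma
    [birkhoff_sum_unbounded]): otherwise they would be bounded below almost
    everywhere by ergodicity, and a function with this property has a
    nonnegative mean.

    Two facts about monotone functions turn the almost everywhere bounds on the
    derivative into bounds on lengths: a monotone function whose difference
    quotients are locally at least [k] off a null set grows at rate [k] (lemma
    [monotone_expansion]), and a function that is differentiable off a countable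
    set maps null sets to null sets (lemma [negligible_image]).  The topology of
    the base space plays no role. *)

(** * Null sets of the line *)

Section null_sets.
Context {R : realType}.
Notation leb := (@lebesgue_measure R).
Implicit Types (E N : set R) (F H : R -> R).

Lemma null_subset (E N : set R) : E `<=` N -> leb.-negligible N -> leb.-negligible E.
Proof. exact: (@negligibleS _ (measurableTypeR R) _ leb). Qed.

Lemma countable_null (N : set R) : countable N -> leb.-negligible N.
Proof.
move=> cN; exists N; split=> //; first exact: countable_measurable.
exact: countable_lebesgue_measure0.
Qed.

Lemma negligible_small_cover E :
  (forall eps : R, 0 < eps -> exists2 B : set R,
     measurable B /\ E `<=` B & (leb B <= eps%:E)%E) -> leb.-negligible E.
Proof.
move=> small; apply/negligible_outer_measure/eqP.
rewrite eq_le outer_measure_ge0 andbT; apply/lee_addgt0Pr => e e0; rewrite add0e.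
have [B [mB EB] Be] := small e e0.
by apply: le_trans Be; exact: le_outer_measure.
Qed.

(** A Lipschitz image of a null set is null; the Lipschitz condition is only
    needed between points that are close to each other. *)
Lemma negligible_lipschitz_image E F (K delta : R) :
  0 < K -> 0 < delta -> leb.-negligible E ->
  (forall x y, E x -> E y -> `|x - y| < delta ->
     `|F x - F y| <= K * `|x - y|) ->
  leb.-negligible (F @` E).
Proof.
move=> K0 d0 [N [mN N0 EN]] FK; apply: negligible_small_cover => eps eps0.
(* The null set is covered by intervals of total length less than [eta]: each
   is shorter than [delta], and the images have total length below [eps]. *)
pose eta := Num.min (delta / 2) (eps / (2 * K)).
have eta0 : 0 < eta by rewrite lt_min !divr_gt0// mulr_gt0.
have /ereal_inf_lt[z [/= M' [mM' NM'] sMz zDe]] : (leb N < eta%:E)%E.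
  by rewrite N0 lte_fin.
have M'E k : exists l : R, [/\ 0 <= l, wlength idfun (M' k) = l%:E &
    exists u, forall x, M' k x -> u < x <= u + l].
  have /ocitvP[->|[[u v] /= uv ->]] : ocitv (M' k) by exact: mM'.
    by exists 0; rewrite lexx wlength0; split=> //; exists 0.
  exists (v - u); rewrite subr_ge0 ltW//; split => //.
    by rewrite wlength_itv /= lte_fin uv.
  by exists u => x /=; rewrite in_itv/= subrKC.
have /choice[l lE] := M'E.
have suml : (\sum_(k <oo) (l k)%:E < eta%:E)%E.
  apply: le_lt_trans zDe; rewrite -sMz; apply: lee_nneseries => // k.
  by move=> _ _; have [? _ _] := lE k; rewrite lee_fin.
  by move=> _; have [_ -> _] := lE k.
have l_lt k : l k < eta.
  rewrite -lte_fin; apply: le_lt_trans suml.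
  rewrite (@nneseriesD1 _ _ k)//; last first.
    by move=> j _; have [? _ _] := lE j; rewrite lee_fin.
  rewrite leeDl//; apply: nneseries_ge0 => j _ _.
  by have [? _ _] := lE j; rewrite lee_fin.
have /choice[B BE] : forall k, exists B : set R, [/\ measurable B,
    F @` (E `&` M' k) `<=` B & (leb B <= (2 * K)%:E * (l k)%:E)%E].
  move=> k; have [l0 _ [u ul]] := lE k.
  have [[x [Ex M'x]]|/forallNP nex] := pselect (exists x, (E `&` M' k) x); last first.
    exists set0; split=> //; first by move=> y [x /nex].
    by rewrite measure0 mule_ge0// lee_fin ?mulr_ge0// ltW.
  exists `[F x - K * l k, F x + K * l k]%classic; split.
  - exact: measurable_itv.
  - move=> _ [y [Ey M'y] <-] /=; rewrite in_itv/= -ler_distlC.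
    have xyl : `|x - y| <= l k.
      move: (ul _ M'x) (ul _ M'y) => /andP[? ?] /andP[? ?].
      by rewrite ler_norml; lra.
    apply: le_trans (FK _ _ _ _ _) _ => //; last by rewrite ler_pM2l.
    apply: le_lt_trans xyl _; apply: lt_le_trans (l_lt k) _.
    by rewrite ge_min; apply/orP; left; lra.
  - rewrite lebesgue_measure_itv/= lte_fin; case: ifPn => _.
      by rewrite -EFinB -EFinM lee_fin; lra.
    by rewrite -EFinM lee_fin !mulr_ge0// ltW.
exists (\bigcup_k B k).
  split; first by apply: bigcup_measurable => k _; have [] := BE k.
  move=> _ [x Ex <-]; have [k _ M'k] := NM' _ (EN _ Ex).
  by exists k => //; have [_ + _] := BE k; apply; exists x.
apply: le_trans (measure_sigma_subadditive _ _ _ (@subset_refl _ _)) _.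
- by move=> k; have [] := BE k.
- by apply: bigcup_measurable => k _; have [] := BE k.
apply: (@le_trans _ _ (\sum_(k <oo) ((2 * K)%:E * (l k)%:E))%E).
  by apply: lee_nneseries => // k _; have [] := BE k.
rewrite nneseriesZl//; last first.
  by move=> k _; have [? _ _] := lE k; rewrite lee_fin.
have -> : eps%:E = ((2 * K)%:E * (eps / (2 * K))%:E)%E.
  by rewrite -EFinM; congr (_%:E); field; rewrite gt_eqF.
rewrite lee_pmul2l// ?lte_fin ?mulr_gt0//.
by apply: le_trans (ltW suml) _; rewrite lee_fin ge_min lexx orbT.
Qed.
End null_sets.

(** * Growth of monotone functions and Lusin's condition *)

Section growth.
Context {R : realType}.
Notation leb := (@lebesgue_measure R).
Implicit Types (D E N : set R) (F H : R -> R).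

(** No continuity of [H] is assumed: the supremum of the points [y] with
    [H x <= H y] belongs to this set, and cannot be less than [z]. *)
Lemma locally_nondecreasing H (x z : R) : x <= z ->
  (forall t, x <= t <= z -> exists2 delta : R, 0 < delta &
     forall y, x <= y <= z -> `|y - t| < delta ->
       (t <= y -> H t <= H y) /\ (y <= t -> H y <= H t)) ->
  H x <= H z.
Proof.
move=> xz loc; pose A := [set y | x <= y <= z /\ H x <= H y].
have Ax : A x by rewrite /A/= lexx xz.
have Aub : has_ubound A by exists z => y [/andP[]].
have supA : has_sup A by split=> //; exists x.
have xs : x <= sup A by exact: ub_le_sup.
have sz : sup A <= z by apply: ge_sup; [exists x|move=> y [/andP[]]].
have [delta d0 locs] : exists2 delta : R, 0 < delta &
     forall y, x <= y <= z -> `|y - sup A| < delta ->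
       (sup A <= y -> H (sup A) <= H y) /\ (y <= sup A -> H y <= H (sup A)).
  by apply: loc; rewrite xs sz.
have [y Ay ys] := sup_adherent d0 supA.
have yle : y <= sup A by exact: ub_le_sup.
have HxA : H x <= H (sup A).
  have [ityz Hxy] := Ay; apply: le_trans Hxy _.
  have [|_] := locs y ityz; last exact.
  by rewrite distrC ger0_norm ?subr_ge0//; lra.
have [->//|szN] := eqVneq z (sup A).
have {szN}sz' : sup A < z by rewrite lt_neqAle eq_sym szN.
pose w := Num.min z (sup A + delta / 2).
have sw : sup A < w by rewrite lt_min sz'/= ltrDl divr_gt0.
have wz : w <= z by rewrite ge_min lexx.
have wd : w <= sup A + delta / 2 by rewrite ge_min lexx orbT.
have xwz : x <= w <= z by rewrite wz andbT (le_trans xs)// ltW.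
suff : A w by move/(ub_le_sup Aub); rewrite leNgt sw.
split=> //; apply: le_trans HxA _.
have [|+ _] := locs w xwz; last by apply; exact: ltW.
by rewrite ger0_norm ?subr_ge0 ?(ltW sw)//; lra.
Qed.

(** The exceptional null set is absorbed by adding to [F] the small monotone
    function [y |-> k * leb (U `&` ]x, y])], where the open set [U] contains
    the null set: it grows at rate [k] on [U]. *)
Lemma nondecreasing_expansion F N (k x z : R) : 0 <= k -> x <= z ->
  leb.-negligible N ->
  (forall u v, x <= u -> u <= v -> v <= z -> F u <= F v) ->
  (forall t, x <= t <= z -> ~ N t -> exists2 delta : R, 0 < delta &
     forall y, x <= y <= z -> `|y - t| < delta ->
       k * `|y - t| <= `|F y - F t|) ->
  k * (z - x) <= F z - F x.
Proof.
move=> k0 xz [N' [mN' N'0 NN']] Fnd loc.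
(* Adding [k * psi] below costs at most [k * eps]. *)
suff small : forall eps, 0 < eps -> k * (z - x) <= F z - F x + k * eps.
  have [->|kN0] := eqVneq k 0; first by rewrite mul0r subr_ge0 Fnd.
  have {}k0 : 0 < k by rewrite lt_neqAle eq_sym kN0.
  apply/ler_addgt0Pr => e e0.
  have := small (e / k) (divr_gt0 e0 k0).
  by rewrite [k * (e / k)]mulrCA divff// mulr1.
move=> eps eps0.
have N'fin : (leb N' < +oo)%E by rewrite [X in (X < _)%E]N'0 ltry.
have [U [oU N'U Ueps]] := lebesgue_regularity_outer mN' N'fin eps0.
have mU : measurable (U : set (measurableTypeR R)) by exact: open_measurable.
have Ue : (leb U < eps%:E)%E.
  apply: le_lt_trans Ueps; rewrite -[X in (leb X <= _)%E](setDUK N'U).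
  apply: le_trans (measureU2 _ _ _) _ => //; first exact: measurableD.
  by rewrite /= [X in (X + _)%E]N'0 add0e.
(* The measure of the part of [U] between [u] and [v]. *)
pose psi u v := fine (leb (U `&` `]u, v]%classic)).
have mUI u v : measurable (U `&` `]u, v]%classic : set (measurableTypeR R)).
  by apply: measurableI => //; exact: measurable_itv.
have lebUI u v : (leb (U `&` `]u, v]%classic) <= leb U)%E.
  by apply: le_measure; rewrite ?inE.
have finUI u v : leb (U `&` `]u, v]%classic) \is a fin_num.
  by rewrite ge0_fin_numE// (le_lt_trans (lebUI u v))// (lt_trans Ue)// ltry.
have psi0 u v : 0 <= psi u v by apply: fine_ge0; exact: measure_ge0.
have psiD u v w : u <= v -> v <= w -> psi u w = psi u v + psi v w.
  move=> uv vw; rewrite /psi -fineD//; congr fine.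
  rewrite -[RHS]measureU//; first by rewrite -setIUr -itv_bndbnd_setU.
  apply/seteqP; split=> // y [] [_ /=]; rewrite !in_itv/= => /andP[_ yv].
  by move=> [_ /andP[vy _]]; have := lt_le_trans vy yv; rewrite ltxx.
have psiU u v : u <= v -> `]u, v]%classic `<=` U -> psi u v = v - u.
  move=> uv uvU; rewrite /psi setIidr// lebesgue_measure_itv/= lte_fin.
  by move: uv; rewrite le_eqVlt => /predU1P[->|->]; rewrite ?ltxx ?subrr.
have psiz : psi x z <= eps.
  rewrite -lee_fin fineK//; apply: le_trans (lebUI _ _) (ltW Ue).
pose H y := F y - k * y + k * psi x y.
have : H x <= H z.
  apply: locally_nondecreasing => // t /andP[xt tz].
  have [N't|N't] := pselect (N' t); last first.
    have [|nt|delta d0 dP] := loc t; rewrite ?xt ?tz//; first exact: N't (NN' _ nt).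
    exists delta => // y /andP[xy yz] ytd.
    have := dP y; rewrite xy yz => /(_ isT ytd) kF; split=> ty.
      rewrite /H (psiD x t y)// mulrDr.
      have := mulr_ge0 k0 (psi0 t y).
      move: kF; rewrite !ger0_norm ?subr_ge0 ?Fnd//; lra.
    rewrite /H (psiD x y t)// mulrDr.
    have := mulr_ge0 k0 (psi0 y t).
    by move: kF; rewrite !ler0_norm ?subr_le0 ?Fnd//; lra.
  have /nbhs_ballP[delta /= d0 dU] : nbhs t U.
    by rewrite nbhsE; exists U => //; split=> //; exact: N'U.
  exists delta => // y /andP[xy yz] ytd; split=> ty.
    rewrite /H (psiD x t y)// (psiU t y) ?mulrDr//; last first.
      move=> w /=; rewrite in_itv/= => /andP[tw wy]; apply: dU.
      by rewrite /ball/= ltr_distlC; move: ytd; rewrite ltr_norml; lra.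
    by have := Fnd t y xt ty yz; lra.
  rewrite /H (psiD x y t)// (psiU y t) ?mulrDr//; last first.
    move=> w /=; rewrite in_itv/= => /andP[yw wt]; apply: dU.
    by rewrite /ball/= ltr_distlC; move: ytd; rewrite ltr_norml; lra.
  by have := Fnd y t xy ty tz; lra.
have -> : H x = F x - k * x.
  by rewrite /H /psi set_itv_ge ?bnd_simp ?ltxx// setI0 measure0 mulr0 addr0.
have := ler_wpM2l k0 psiz; rewrite /H; lra.
Qed.

Lemma monotone_expansion F N (k x z : R) : 0 <= k -> x <= z ->
  leb.-negligible N ->
  (forall u v, x <= u -> u <= v -> v <= z -> F u <= F v) \/
  (forall u v, x <= u -> u <= v -> v <= z -> F v <= F u) ->
  (forall t, x <= t <= z -> ~ N t -> exists2 delta : R, 0 < delta &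
     forall y, x <= y <= z -> `|y - t| < delta ->
       k * `|y - t| <= `|F y - F t|) ->
  k * (z - x) <= `|F z - F x|.
Proof.
move=> k0 xz N0 [Fnd|Fni] loc.
  by apply: le_trans (ler_norm _); exact: nondecreasing_expansion N0 Fnd loc.
rewrite -normrN opprB -[F x - F z]addrC -[F x]opprK.
apply: le_trans (ler_norm _).
apply: (@nondecreasing_expansion (fun y => - F y) N) => // [u v ? ? ?|t txz Nt].
  by rewrite lerN2 Fni.
have [delta d0 dP] := loc t txz Nt; exists delta => // y yxz ytd.
by rewrite -opprD normrN; exact: dP.
Qed.

(** Lusin's condition N: if [F] is pointwise Lipschitz, with respect to the
    points of [D], at all but countably many points of [D], then it maps null
    subsets of [D] to null sets. *)
Lemma negligible_image D E C F : leb.-negligible E -> E `<=` D -> countable C ->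
  (forall x, D x -> ~ C x -> exists K delta : R, [/\ 0 < K, 0 < delta &
     forall y, D y -> `|y - x| < delta -> `|F y - F x| <= K * `|y - x|]) ->
  leb.-negligible (F @` E).
Proof.
move=> E0 ED cC lip.
(* The points of [E] at which [F] is Lipschitz with constant [n.+1] at
   distance [n.+1%:R^-1]. *)
pose En n := [set x | E x /\ forall y, D y -> `|y - x| < n.+1%:R^-1 ->
  `|F y - F x| <= n.+1%:R * `|y - x| ].
have FE : F @` E `<=` F @` C `|` \bigcup_n (F @` En n).
  move=> _ [x Ex <-]; have [Cx|Cx] := pselect (C x); first by left; exists x.
  right; have [K [delta [K0 d0 KF]]] := lip x (ED _ Ex) Cx.
  pose n := Num.truncn (Num.max K delta^-1).
  have nP : Num.max K delta^-1 < n.+1%:R by exact: truncnS_gt.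
  exists n => //; exists x => //; split=> // y Dy yx.
  apply: le_trans (KF _ Dy _) _.
    apply: lt_le_trans yx _; rewrite -[leRHS]invrK lef_pV2 ?posrE// ?invr_gt0//.
    by apply: le_trans (ltW nP); rewrite le_max lexx orbT.
  rewrite ler_wpM2r//; apply: le_trans (ltW nP).
  by rewrite le_max lexx.
apply: (null_subset FE); apply: negligibleU.
  have cFC : countable (F @` C) by exact: sub_countable (card_image_le _ _) cC.
  exact: countable_null.
apply: negligible_bigcup => n.
apply: (@negligible_lipschitz_image _ _ _ n.+1%:R n.+1%:R^-1); rewrite ?invr_gt0//.
  by apply: null_subset E0 => x [].
move=> x y [Ex _] [Ey yP] xy; apply: yP => //; exact: ED.
Qed.
End growth.

(** * A single monotone branch *)

Section derivative_bounds.
Context {R : realType}.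
Implicit Types (F : R -> R) (t k : R).

Lemma derivable_lower F t k : derivable F t 1 -> k < `|derive1 F t| ->
  exists2 delta : R, 0 < delta &
    forall y, `|y - t| < delta -> k * `|y - t| <= `|F y - F t|.
Proof.
move=> dF kF.
have : `|h^-1 *: (F (h *: 1 + t) - F t)| @[h --> 0^'] --> `|derive1 F t|.
  by apply: cvg_norm; rewrite derive1E; exact: dF.
move=> /cvgr_gt/(_ _ kF)/nbhs_ballP[delta /= d0 dP].
exists delta => // y yt; have [->|yNt] := eqVneq y t.
  by rewrite !subrr normr0 mulr0.
have := dP (y - t); rewrite /ball/= sub0r normrN subr_eq0 => /(_ yt yNt).
rewrite /GRing.scale/= mulr1 subrK normrM normfV => /ltW.
by rewrite mulrC ler_pdivlMr// normr_gt0 subr_eq0.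
Qed.

Lemma derivable_upper F t k : derivable F t 1 -> `|derive1 F t| < k ->
  exists2 delta : R, 0 < delta &
    forall y, `|y - t| < delta -> `|F y - F t| <= k * `|y - t|.
Proof.
move=> dF kF.
have : `|h^-1 *: (F (h *: 1 + t) - F t)| @[h --> 0^'] --> `|derive1 F t|.
  by apply: cvg_norm; rewrite derive1E; exact: dF.
move=> /cvgr_lt/(_ _ kF)/nbhs_ballP[delta /= d0 dP].
exists delta => // y yt; have [->|yNt] := eqVneq y t.
  by rewrite !subrr normr0 mulr0.
have := dP (y - t); rewrite /ball/= sub0r normrN subr_eq0 => /(_ yt yNt).
rewrite /GRing.scale/= mulr1 subrK normrM normfV => /ltW.
by rewrite mulrC ler_pdivrMr// normr_gt0 subr_eq0.
Qed.

Lemma ler_wpM_lt (k u v : R) : 0 <= k -> 0 <= u ->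
  (forall k', 0 <= k' -> k' < k -> k' * u <= v) -> 0 <= v -> k * u <= v.
Proof.
move=> k0 u0 lekv v0; rewrite leNgt; apply/negP => vku.
have {}u0 : 0 < u.
  by rewrite lt_neqAle u0 andbT; apply/eqP => u00; move: vku; rewrite -u00 mulr0 ltNge v0.
have vuk : v / u < k by rewrite ltr_pdivrMr.
have vu0 : 0 <= v / u by rewrite divr_ge0// ltW.
have := lekv ((v / u + k) / 2) ltac:(by lra) ltac:(by lra).
by rewrite -ler_pdivlMr// => ?; lra.
Qed.

End derivative_bounds.

Section branch.
Context {R : realType}.
Notation leb := (@lebesgue_measure R).
Variables (p q : R) (T : R -> R).
Notation D := `]p, q[%classic.
Hypothesis Tcont : {within D, continuous T}.
Hypothesis Tmono : {in D &, {homo T : x y / x <= y}} \/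
    {in D &, {homo T : x y / x <= y >-> y <= x}}.
Variable N : set R.
Hypothesis Ncount : countable N.
Hypothesis Tder : forall x, D x -> ~ N x -> derivable T x 1 /\ derive1 T x != 0.

Lemma subset_branch (x z : R) : D x -> D z -> `[x, z]%classic `<=` D.
Proof.
move=> /=; rewrite !in_itv/= => /andP[px _] /andP[_ zq] t /=.
by rewrite !in_itv/= => /andP[xt tz]; rewrite (lt_le_trans px)// (le_lt_trans tz).
Qed.

Lemma branch_mono (x z : R) : D x -> D z ->
  (forall u v, x <= u -> u <= v -> v <= z -> T u <= T v) \/
  (forall u v, x <= u -> u <= v -> v <= z -> T v <= T u).
Proof.
move=> Dx Dz; have DI u v : x <= u -> u <= v -> v <= z -> u \in D /\ v \in D.
  move=> xu uv vz; split; apply/mem_set; apply: (subset_branch Dx Dz); rewrite /= in_itv/=.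
    by rewrite xu (le_trans uv).
  by rewrite vz (le_trans xu).
by case: Tmono => Tm; [left|right] => u v xu uv vz; have [Du Dv] := DI u v xu uv vz;
  exact: Tm.
Qed.

Lemma branch_injective : {in D &, injective T}.
Proof.
move=> x y /set_mem Dx /set_mem Dy; wlog xy : x y Dx Dy / x < y.
  move=> h Txy; have [xy|yx|//] := ltgtP x y; first exact: h.
  by apply/esym; exact: h.
move=> Txy; exfalso.
(* [T] would be constant on [[x, y]], which contains points where its
   derivative is not zero. *)
have cst t : x <= t <= y -> T t = T x.
  move=> /andP[xt ty]; apply/eqP; rewrite eq_le.
  have [Tm|Tm] := branch_mono Dx Dy.
    by rewrite [in T t <= _]Txy !Tm.
  by rewrite [in T x <= _]Txy !Tm.
have [t xty Nt] : exists2 t, `]x, y[%classic t & ~ N t.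
  apply: contrapT => /forall2NP NP.
  have : countable `]x, y[%classic.
    apply: sub_countable Ncount; apply: subset_card_le => t xty.
    by have [//|/contrapT] := NP t.
  move=> /countable_lebesgue_measure0; rewrite lebesgue_measure_itv/= lte_fin xy.
  by move/eqP; rewrite -EFinB eqe subr_eq0 => /eqP yx; rewrite yx ltxx in xy.
move: xty; rewrite /= in_itv/= => /andP[xt ty].
have Dt : D t by apply: (subset_branch Dx Dy); rewrite /= in_itv/= !ltW.
have [dT T'0] := Tder Dt Nt; rewrite -normr_gt0 in T'0.
have [|delta d0 dP] := @derivable_lower _ T t (`|derive1 T t| / 2) dT.
  by lra.
pose u := Num.min y (t + delta / 2).
have tu : t < u by rewrite lt_min ty ltrDl divr_gt0.
have uy : u <= y by rewrite ge_min lexx.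
have ud : u <= t + delta / 2 by rewrite ge_min lexx orbT.
have TuE : T u = T t.
  rewrite (cst t); last by rewrite !ltW.
  by rewrite (cst u)// uy andbT ltW// (lt_trans xt).
have := dP u; rewrite TuE subrr normr0 gtr0_norm ?subr_gt0// => /(_ ltac:(by lra)).
by rewrite leNgt mulr_gt0// ?divr_gt0// subr_gt0.
Qed.

Lemma branch_null_image E : E `<=` D -> leb.-negligible E ->
  leb.-negligible (T @` E).
Proof.
move=> ED E0; apply: (negligible_image E0 ED Ncount) => x Dx Nx.
have [dT _] := Tder Dx Nx.
have [|delta d0 dP] := @derivable_upper _ T x (`|derive1 T x| + 1) dT.
  by rewrite ltrDl.
by exists (`|derive1 T x| + 1), delta; split=> // y _; exact: dP.
Qed.

Lemma branch_expansion (k x z : R) : 0 <= k -> D x -> D z -> x <= z ->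
  leb.-negligible (D `&` [set t | `|derive1 T t| < k]) ->
  k * (z - x) <= `|T z - T x|.
Proof.
move=> k0 Dx Dz xz bad; apply: ler_wpM_lt => // [|k' k'0 k'k]; first by rewrite subr_ge0.
apply: (@monotone_expansion _ _ (D `&` [set t | `|derive1 T t| < k] `|` N)) => //.
- by apply: negligibleU => //; exact: countable_null.
- exact: branch_mono.
- move=> t xtz /not_orP[/not_andP Nbad Nt].
  have Dt : D t by exact: (subset_branch Dx Dz).
  case: Nbad => // /negP; rewrite -leNgt => kT.
  have [|delta d0 dP] := @derivable_lower _ T t k' (Tder Dt Nt).1.
    exact: lt_le_trans kT.
  by exists delta => // y _; exact: dP.
Qed.

Lemma branch_ivt (x z v : R) : D x -> D z -> x <= z ->
  Num.min (T x) (T z) <= v <= Num.max (T x) (T z) ->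
  exists2 c, x <= c <= z & T c = v.
Proof.
move=> Dx Dz xz vP.
have Txz : {within `[x, z], continuous T}.
  by apply: continuous_subspaceW Tcont; exact: subset_branch.
by have [c xcz <-] := IVT xz Txz vP; exists c => //; rewrite in_itv in xcz.
Qed.

(** The inverse branch expands at rate [K^-1] off the image of the exceptional
    set, which is null, so the growth estimate applies to it. *)
Lemma branch_inverse_expansion (K u v : R) : 0 < K ->
  (T @` D) u -> (T @` D) v -> u <= v ->
  leb.-negligible (D `&` [set t | K < `|derive1 T t|]) ->
  v - u <= K * (q - p).
Proof.
move=> K0 Du Dv uv bad; rewrite -ler_pdivrMl//.
have S_in w : (T @` D) w -> D (pinv D T w).
  move=> Dw; have [+ _ _] := injpinv_bij (fun=> point) branch_injective.
  exact.
have TS w : (T @` D) w -> T (pinv D T w) = w by move=> Dw; rewrite pinvK ?inE.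
have TDuv w : u <= w <= v -> (T @` D) w.
  case: Du Dv => x Dx <- [z Dz <-] wP.
  suff [c Dc <-] : exists2 c, D c & T c = w by exists c.
  have [xz|/ltW zx] := leP x z.
    have [|c xcz Tc] := @branch_ivt x z w Dx Dz xz.
      by case/andP: wP => ? ?; rewrite ge_min le_max; apply/andP; split; apply/orP; [left|right].
    by exists c => //; exact: (subset_branch Dx Dz).
  have [|c xcz Tc] := @branch_ivt z x w Dz Dx zx.
    by case/andP: wP => ? ?; rewrite ge_min le_max; apply/andP; split; apply/orP; [right|left].
  by exists c => //; exact: (subset_branch Dz Dx).
apply: (@le_trans _ _ `|pinv D T v - pinv D T u|); last first.
  move: (S_in _ Du) (S_in _ Dv) => /=; rewrite !in_itv/= => /andP[? ?] /andP[? ?].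
  by rewrite ler_norml; lra.
apply: ler_wpM_lt; rewrite ?invr_ge0 ?subr_ge0// ?(ltW K0)// => k k0 kK.
apply: (@monotone_expansion _ _
  (T @` (D `&` [set t | K < `|derive1 T t|] `|` (D `&` N)))) => //.
- apply: branch_null_image; first by move=> t [[]|[]].
  apply: negligibleU => //; apply: (@null_subset _ _ N); first by move=> t [].
  exact: countable_null.
- have Sin w : u <= w <= v -> pinv D T w \in D by move=> /TDuv/S_in/mem_set.
  case: Tmono => Tm; [left|right] => w1 w2 uw1 w12 w2v.
    have w1P : u <= w1 <= v by rewrite uw1 (le_trans w12).
    have w2P : u <= w2 <= v by rewrite w2v (le_trans uw1).
    rewrite leNgt; apply/negP => S21.
    have := Tm _ _ (Sin _ w2P) (Sin _ w1P) (ltW S21).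
    rewrite !TS; [|exact: TDuv|exact: TDuv] => w21.
    have w1E : w1 = w2 by apply/eqP; rewrite eq_le w12.
    by move: S21; rewrite w1E ltxx.
  have w1P : u <= w1 <= v by rewrite uw1 (le_trans w12).
  have w2P : u <= w2 <= v by rewrite w2v (le_trans uw1).
  rewrite leNgt; apply/negP => S12.
  have := Tm _ _ (Sin _ w1P) (Sin _ w2P) (ltW S12).
  rewrite !TS; [|exact: TDuv|exact: TDuv] => w21.
  have w1E : w1 = w2 by apply/eqP; rewrite eq_le w12.
  by move: S12; rewrite w1E ltxx.
- move=> w wP /= Nw.
  have [->|kN0] := eqVneq k 0; first by exists 1 => // y _ _; rewrite mul0r.
  have {kN0}k0' : 0 < k by rewrite lt_neqAle eq_sym kN0.
  have Dw := TDuv _ wP; have Dx := S_in _ Dw.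
  have NSw : ~ N (pinv D T w).
    by move=> NS; apply: Nw; exists (pinv D T w); [right|exact: TS].
  have T'K : `|derive1 T (pinv D T w)| < k^-1.
    apply: (@le_lt_trans _ _ K); last by rewrite -[K]invrK ltf_pV2 ?posrE ?invr_gt0.
    rewrite leNgt; apply/negP => KT.
    by apply: Nw; exists (pinv D T w); [left|exact: TS].
  have [delta d0 dP] := derivable_upper (Tder Dx NSw).1 T'K.
  exists (k^-1 * delta) => [|y yP yw]; first by rewrite mulr_gt0 ?invr_gt0.
  have [near|far] := ltP `|pinv D T y - pinv D T w| delta.
    have := dP _ near; rewrite !TS//; last exact: TDuv.
    by rewrite ler_pdivlMl.
  apply: le_trans far; rewrite -ler_pdivlMl//; exact: ltW.
Qed.
End branch.

(** * Pieces of an interval cut by a partition *)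

Section partition.
Context {R : realType}.
Variables (a b : R) (s : seq R).
Hypothesis parts : itv_partition a b s.
Notation pt := (nth b (a :: s)).
Notation atom := (@atom R a b s).

Lemma partition_lt (i j : nat) : (i < j)%N -> (j <= size s)%N -> pt i < pt j.
Proof.
have [path_s _] := parts => ij js; have sorted_s : sorted <%O (a :: s) := path_s.
by rewrite (lt_sorted_ltn_nth b sorted_s) ?inE//= ltnS// ltnW// (leq_trans ij).
Qed.

Lemma partition_le (i j : nat) : (i <= j)%N -> (j <= size s)%N -> pt i <= pt j.
Proof.
by rewrite leq_eqVlt => /predU1P[->//|ij] js; rewrite ltW// partition_lt.
Qed.

Lemma partition_last : pt (size s) = b.
Proof. exact: itv_partition_nth_size parts. Qed.

Lemma atom_sub i : atom i `<=` `[a, b]%classic.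
Proof.
move=> x; rewrite /atom /= !in_itv/= => /andP[lox xhi].
have hib : pt i.+1 <= b by rewrite -[leRHS]partition_last partition_le.
have alo : a <= pt i by rewrite -[a]/(pt 0) partition_le// ltnW.
by rewrite (le_trans alo)/= ?(le_trans _ hib)// ltW.
Qed.

(** The increments of a function over the atoms add up. *)
Lemma sum_partition (f : R -> R) :
  \sum_(i < size s) (f (pt i.+1) - f (pt i)) = f b - f a.
Proof.
rewrite -(big_mkord xpredT (fun i => f (pt i.+1) - f (pt i))).
by rewrite telescope_sumr// partition_last.
Qed.

(** An open interval that contains no full atom meets at most [xi T s + 2]
    atoms: those that it contains form a contiguous family, and the others
    contain one of its two end points. *)
Lemma large_piece (T : R -> R) (c d : R) : a <= c -> c < d -> d <= b ->
  (forall i, full a b T i -> ~ (atom i `<=` `]c, d[%classic)) ->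
  exists (i : 'I_(size s)) (c' d' : R),
    [/\ c' < d', `]c', d'[%classic `<=` `]c, d[%classic `&` atom i &
        d - c <= (xi a b T s + 2)%:R * (d' - c')].
Proof.
move=> ac cd db nofull.
(* The projection to [[c, d]]; [len i] is the length of the part of atom [i]
   between [c] and [d]. *)
pose kap x := Num.max c (Num.min x d).
pose len (i : 'I_(size s)) := kap (pt i.+1) - kap (pt i).
have sumlen : \sum_i len i = d - c.
  rewrite /len sum_partition /kap (min_r db) (max_r (ltW cd)).
  by rewrite (min_l (le_trans ac (ltW cd))) (max_l ac).
have len0 i : 0 <= len i.
  rewrite subr_ge0 /kap; apply: le_max2 => //; apply: le_min2 => //.
  exact: partition_le.
pose P := [set i | 0 < len i]%SET.
have cardP : (#|P| <= xi a b T s + 2)%N.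
  pose A := [set i : 'I_(size s) | (c <= pt i) && (pt i.+1 <= d)]%SET.
  pose B x := [set i : 'I_(size s) | (pt i < x) && (x < pt i.+1)]%SET.
  (* [A]: the atoms inside the interval; [B x]: the atoms that contain [x]. *)
  have Axi : (#|A| <= xi a b T s)%N.
    apply: (@leq_bigmax_cond _ _ (fun A : {set 'I_(size s)} => #|A|)).
    have Acd i : i \in A -> atom i `<=` `]c, d[%classic.
      rewrite inE => /andP[ci di] x /=; rewrite !in_itv/= => /andP[ix xi].
      by rewrite (le_lt_trans ci)//= (lt_le_trans xi).
    apply/asboolP; split=> [i /Acd Ai /nofull|k /nofull kcd]; first exact.
    apply: contra_not kcd => /subset_trans; apply.
    rewrite Rhull_smallest; apply: smallest_sub; first exact: interval_is_interval.
    by apply: bigcup_sub => i /Acd.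
  have B1 x : (#|B x| <= 1)%N.
    apply/card_le1_eqP => i j; rewrite !inE => /andP[ix xi] /andP[jx xj].
    apply/val_inj; case: (ltngtP i j) => //= ij.
      by have := lt_trans jx xi; rewrite ltNge partition_le// ltnW.
    by have := lt_trans ix xj; rewrite ltNge partition_le// ltnW.
  have PAB : P \subset (A :|: (B c :|: B d))%SET.
    apply/fintype.subsetP => i; rewrite !inE subr_gt0 /kap.
    move: (pt i) (pt i.+1) => p q lepq.
    have cq : c < q.
      rewrite ltNge; apply/negP => qc; move: lepq.
      by rewrite (max_l (y := Num.min q d)) ?ge_min ?qc// gt_max ltxx.
    have pd : p < d.
      rewrite ltNge; apply/negP => dp; move: lepq.
      by rewrite (min_r dp) ltNge le_max2// ge_min lexx orbT.
    by rewrite cq pd /= andbT; case: leP => //=; case: leP.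
  apply: leq_trans (subset_leq_card PAB) _.
  apply: leq_trans (leq_card_setU _ _) _; rewrite leq_add//.
  by apply: leq_trans (leq_card_setU _ _) _; rewrite (leq_add (B1 c) (B1 d)).
have [i lei] : exists i, d - c <= (xi a b T s + 2)%:R * len i.
  apply: contrapT => /forallNP small.
  have {}small i : (xi a b T s + 2)%:R * len i < d - c.
    by rewrite ltNge; apply/negP; exact: small.
  have : \sum_(i in P) (xi a b T s + 2)%:R * len i = (xi a b T s + 2)%:R * (d - c).
    rewrite -mulr_sumr -sumlen; congr (_ * _).
    rewrite [RHS](bigID (mem P))/= [X in _ = _ + X]big1 ?addr0// => j.
    by rewrite inE -leNgt => lenj; apply/eqP; rewrite eq_le lenj len0.
  apply/eqP; rewrite lt_eqF//.
  have [P0|[j jP]] := set_0Vmem P.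
    by rewrite P0 big_set0 mulr_gt0 ?ltr0n ?addn2// subr_gt0.
  apply: (@lt_le_trans _ _ (\sum_(i in P) (d - c))).
    by apply: ltr_sum => //; apply/hasP; exists j; rewrite ?mem_index_enum.
  by rewrite sumr_const -[leLHS]mulr_natl ler_wpM2r ?ler_nat// subr_ge0 ltW.
exists i, (kap (pt i)), (kap (pt i.+1)); split=> //.
  rewrite -subr_gt0; move: lei; apply: contraTT; rewrite -leNgt -ltNge => leni.
  have -> : len i = 0 by apply/eqP; rewrite eq_le leni len0.
  by rewrite mulr0 subr_gt0.
move=> x /=; rewrite /atom /= !in_itv/= /kap gt_max lt_max lt_min gt_min.
move=> /andP[/andP[cx /orP[ix|dx]] /orP[xc|/andP[xi xd]]].
- by move: (lt_trans cx xc); rewrite ltxx.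
- by rewrite cx xd ix xi.
- by move: (lt_trans cx xc); rewrite ltxx.
- by move: (lt_trans dx xd); rewrite ltxx.
Qed.

End partition.

(** * One step of a piecewise monotone map *)

Section almost_everywhere.
Context {R : realType}.
Notation leb := (@lebesgue_measure R).

Lemma ae_leb_on (a b : R) (P : R -> Prop) :
  (\forall x \ae leb_on a b, P x) <->
  leb.-negligible (`[a, b]%classic `&` [set x | ~ P x]).
Proof.
split=> [[N [mN N0 PN]]|[N [mN N0 PN]]].
  exists (N `&` `[a, b]%classic); split=> //; first exact: measurableI.
  by move=> x [abx Px]; split=> //; exact: PN.
exists (N `|` ~` `[a, b]%classic); split.
- by apply: measurableU => //; exact: measurableC.
- rewrite /leb_on/= /mrestr setIUl setICl setU0.
  apply/eqP; rewrite eq_le measure_ge0 andbT -[leRHS]N0.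
  by apply: le_measure; rewrite ?inE//; exact: measurableI.
- move=> x /= Px; have [abx|] := pselect (`[a, b]%classic x); last by right.
  by left; apply: PN.
Qed.

End almost_everywhere.

(** [ae_ge A f r]: on the set [A], [f] is at least [r] up to a null set.  No
    measurability of [A] or [f] is assumed. *)
Definition ae_ge {R : realType} (A : set R) (f : R -> R) (r : R) : Prop :=
  (@lebesgue_measure R).-negligible (A `&` [set x | f x < r]).

Section piecewise_map.
Context {R : realType}.
Notation leb := (@lebesgue_measure R).
Variables (a b : R) (T : R -> R) (s : seq R).
Hypothesis ab : a < b.
Hypothesis pm : piecewise_monotone_map a b T s.
Variables (g_min g_max : R).
Hypothesis g_min0 : 0 < g_min.
Hypothesis g_max0 : 0 < g_max.
Hypothesis weight_min :
  leb.-negligible (`[a, b]%classic `&` [set x | weight T x < g_min]).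
Hypothesis weight_max :
  leb.-negligible (`[a, b]%classic `&` [set x | g_max < weight T x]).
Notation pt := (nth b (a :: s)).
Notation atom := (@atom R a b s).

Let parts : itv_partition a b s := pm_partition pm.

Lemma weight_ge0 x : 0 <= weight T x.
Proof. by rewrite /weight invr_ge0. Qed.

Lemma atom_small_slope (i : 'I_(size s)) :
  leb.-negligible (atom i `&` [set t | `|derive1 T t| < g_max^-1]).
Proof.
have [N Ncount Tder] := pm_derivable pm.
apply: (@null_subset _ _ (`[a, b]%classic `&` [set x | g_max < weight T x] `|` N)).
  move=> t [it] /= T't; have [Nt|Nt] := pselect (N t); [by right|left].
  split; first exact: (atom_sub parts it).
  rewrite /= /weight -[ltLHS]invrK ltf_pV2 ?posrE ?invr_gt0//.
  by rewrite normr_gt0; have [] := Tder i t it Nt.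
by apply: negligibleU => //; exact: countable_null.
Qed.

Lemma atom_large_slope (i : 'I_(size s)) :
  leb.-negligible (atom i `&` [set t | g_min^-1 < `|derive1 T t|]).
Proof.
apply: null_subset weight_min => t [it] /= T't; split; first exact: (atom_sub parts it).
have T'0 : 0 < `|derive1 T t| by apply: lt_trans T't; rewrite invr_gt0.
by rewrite /= /weight -[ltRHS]invrK ltf_pV2 ?posrE ?invr_gt0.
Qed.

(** The inverse of a full branch expands at rate [g_min] almost everywhere. *)
Lemma full_atom_length (i : 'I_(size s)) : full a b T i ->
  g_min * (b - a) <= pt i.+1 - pt i.
Proof.
move=> full_i; have [N Ncount Tder] := pm_derivable pm.
rewrite -[g_min]invrK ler_pdivrMl ?invr_gt0//.
have hit (c d : R) : a <= c -> c < d -> d <= b ->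
    exists2 y, `]c, d[%classic y & (T @` atom i) y.
  move=> ac cd db; apply: contrapT => /forall2NP nohit.
  have : (leb `]c, d[%classic <= 0)%E.
    rewrite -[leRHS]full_i; apply: le_outer_measure => y cdy; split.
      move: cdy; rewrite /= !in_itv/= => /andP[cy yd].
      by rewrite (le_trans ac (ltW cy)) (le_trans (ltW yd) db).
    by have [/(_ cdy)|] := nohit y.
  by rewrite lebesgue_measure_itv/= lte_fin cd -EFinB lee_fin subr_le0 leNgt cd.
apply/ler_addgt0Pr => eta eta0.
(* The image may miss null sets near [a] and [b]. *)
pose h := Num.min ((b - a) / 2) (eta / 2).
have h0 : 0 < h by rewrite lt_min !divr_gt0// subr_gt0.
have h1 : h <= (b - a) / 2 by rewrite ge_min lexx.
have h2 : h <= eta / 2 by rewrite ge_min lexx orbT.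
have [u + Tu] := hit a (a + h) (lexx _) ltac:(lra) ltac:(lra).
have [v + Tv] := hit (b - h) b ltac:(lra) ltac:(lra) (lexx _).
rewrite /= !in_itv/= => /andP[? ?] /andP[? ?].
have := @branch_inverse_expansion _ (pt i) (pt i.+1) T (@pm_continuous _ _ _ _ _ pm i)
  (pm_monotone pm i) N Ncount (Tder i) g_min^-1 u v
  ltac:(by rewrite invr_gt0) Tu Tv ltac:(lra) (@atom_large_slope i).
lra.
Qed.

Lemma nb_full_bound : g_min * (nb_full a b T s)%:R <= 1.
Proof.
have ba0 : 0 < b - a by rewrite subr_gt0.
rewrite -(ler_pM2r ba0) mul1r.
rewrite -[leRHS](sum_partition parts id).
apply: (@le_trans _ _ (\sum_(i < size s | `[< full a b T i >]) (pt i.+1 - pt i))).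
  rewrite mulrAC mulr_natr -sumr_const.
  rewrite [leLHS](eq_bigl (fun i => `[< full a b T i >])); last first.
    by move=> i; rewrite inE.
  by apply: ler_sum => i /asboolP; exact: full_atom_length.
rewrite [leRHS](bigID (fun i => `[< full a b T i >]))/= lerDl.
apply: sumr_ge0 => i _; rewrite subr_ge0 /=; exact: (partition_le parts (leqnSn i)).
Qed.

Lemma nb_full_gt0 : (0 < nb_full a b T s)%N.
Proof.
have [i fi] := pm_full pm; rewrite /nb_full card_gt0; apply/set0Pn; exists i.
by rewrite inE; apply/asboolP.
Qed.

Lemma transfer_ge0 (f : R -> R) : (forall x, 0 <= f x) ->
  forall y, 0 <= transfer a b T s f y.
Proof.
move=> f0 y; apply: sumr_ge0 => i _; rewrite /= mulr_ge0// ?mulr_ge0// ?weight_ge0//.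
Qed.

(** The bound holds off the image of the null set where [f] or the weight is
    too small; keeping a single term of the sum is enough. *)
Lemma transfer_ae_ge (f : R -> R) (i : 'I_(size s)) (A : set R) (r : R) :
  (forall x, 0 <= f x) -> 0 <= r -> A `<=` atom i -> ae_ge A f r ->
  ae_ge (T @` A) (transfer a b T s f) (r * g_min).
Proof.
move=> f0 r0 Ai fr; have [N Ncount Tder] := pm_derivable pm.
have inj := branch_injective (pm_monotone pm i) Ncount (Tder i).
apply: (@null_subset _ _ (T @` ((A `&` [set x | f x < r]) `|`
    (A `&` [set x | weight T x < g_min])))); last first.
  apply: (branch_null_image Ncount (Tder i)); first by move=> x [[/Ai]|[/Ai]].
  apply: negligibleU => //; apply: null_subset weight_min => x [/Ai/(atom_sub parts)].
  by [].
move=> _ [[x Ax <-]] /= Lf; exists x => //; apply: contrapT => /not_orP[/not_andP fx gx].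
have {}fx : r <= f x by case: fx => // /negP; rewrite -leNgt.
have {}gx : g_min <= weight T x by case/not_andP: gx => // /negP; rewrite -leNgt.
move: Lf; apply/negP; rewrite -leNgt.
rewrite /transfer (bigD1 i)//= -[leLHS]addr0; apply: lerD; last first.
  by apply: sumr_ge0 => j _; rewrite mulr_ge0// mulr_ge0// weight_ge0.
rewrite indicE mem_set ?mul1r; last by exists x => //; exact: Ai.
rewrite pinvKV//; last exact/mem_set/Ai.
by rewrite ler_pM// ltW.
Qed.

(** The end points are moved inside by a sixth of the length, since they may be
    end points of the atom, where nothing is known of [T]; two thirds of the
    length remain. *)
Lemma image_contains_interval (i : 'I_(size s)) (c d : R) :
  c < d -> `]c, d[%classic `<=` atom i ->
  exists u v : R, [/\ u < v, `]u, v[%classic `<=` T @` `]c, d[%classic &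
     d - c <= 3 / 2 * g_max * (v - u)].
Proof.
move=> cd cdi; have [N Ncount Tder] := pm_derivable pm.
pose x := c + (d - c) / 6; pose z := d - (d - c) / 6.
have xz : x <= z by rewrite /x /z; lra.
have cdx : `]c, d[%classic x by rewrite /= in_itv/= /x; lra.
have cdz : `]c, d[%classic z by rewrite /= in_itv/= /z; lra.
have := @branch_expansion _ _ _ _ (pm_monotone pm i) N Ncount (Tder i) g_max^-1 x z
  ltac:(by rewrite invr_ge0 ltW) (cdi _ cdx) (cdi _ cdz) xz (@atom_small_slope i).
rewrite ler_pdivrMl// => Txz.
pose u := Num.min (T x) (T z); pose v := Num.max (T x) (T z).
have uvE : v - u = `|T z - T x|.
  rewrite /u /v; case: (leP (T x) (T z)) => h.
    by rewrite ger0_norm ?subr_ge0.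
  by rewrite ltr0_norm ?subr_lt0// opprB.
exists u, v; split.
- rewrite -subr_gt0 uvE; move: Txz; apply: contraTT; rewrite -leNgt -ltNge => h.
  have -> : `|T z - T x| = 0 by apply/eqP; rewrite eq_le h normr_ge0.
  by rewrite mulr0 /x /z; lra.
- move=> w /=; rewrite in_itv/= => /andP[uw wv].
  have [//||e xez <-] := @branch_ivt _ _ _ _ (@pm_continuous _ _ _ _ _ pm i) x z w
    (cdi _ cdx) (cdi _ cdz).
    by rewrite !ltW.
  exists e => //; move: xez cdx cdz; rewrite /= !in_itv/=; lra.
- by rewrite uvE; move: Txz; rewrite /x /z; lra.
Qed.

Lemma image_sub (A : set R) : A `<=` `[a, b]%classic -> T @` A `<=` `[a, b]%classic.
Proof. by move=> Aab _ [x Ax <-]; apply: (pm_range pm); exact: Aab. Qed.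

(** One step of the dynamics: either the interval contains a full atom, whose
    image is everything, or the image contains an interval whose length is
    bounded below in terms of the length of the first one. *)
Lemma cover_or_grow (f : R -> R) (c d r : R) :
  a <= c -> c < d -> d <= b -> (forall x, 0 <= f x) -> 0 < r ->
  ae_ge `]c, d[%classic f r ->
  ae_ge `[a, b]%classic (transfer a b T s f) (r * g_min) \/
  exists c' d' : R, [/\ a <= c', c' < d', d' <= b,
    ae_ge `]c', d'[%classic (transfer a b T s f) (r * g_min) &
    d - c <= (xi a b T s + 2)%:R * (3 / 2 * g_max) * (d' - c')].
Proof.
move=> ac cd db f0 r0 fr.
have restr (i : 'I_(size s)) (A : set R) : A `<=` `]c, d[%classic -> A `<=` atom i ->
    ae_ge (T @` A) (transfer a b T s f) (r * g_min).
  move=> Acd Ai; apply: transfer_ae_ge Ai _ => //; first exact: ltW.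
  by apply: null_subset fr => x [/Acd].
have [[i [full_i icd]]|nofull] :=
    pselect (exists i : 'I_(size s), full a b T i /\ atom i `<=` `]c, d[%classic).
  left; apply: (@null_subset _ _ ((`[a, b]%classic `\` (T @` atom i)) `|`
     ((T @` atom i) `&` [set y | transfer a b T s f y < r * g_min]))).
    by move=> y [aby Ly]; have [Ty|Ty] := pselect ((T @` atom i) y); [right|left].
  apply: negligibleU; last exact: (restr i _ icd (@subset_refl _ _)).
  exact/negligible_outer_measure.
right.
have [|i [c' [d' [c'd' c'd'_sub dc]]]] := large_piece parts (T := T) ac cd db.
  by move=> i full_i icd; apply: nofull; exists i.
have c'd'_cd : `]c', d'[%classic `<=` `]c, d[%classic by move=> x /c'd'_sub[].
have c'd'_atom : `]c', d'[%classic `<=` atom i by move=> x /c'd'_sub[].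
have [u [v [uv uv_sub d'c']]] := image_contains_interval c'd' c'd'_atom.
have uv_ab : `]u, v[%classic `<=` `[a, b]%classic.
  apply: subset_trans uv_sub _; apply: image_sub => x /c'd'_atom; exact: atom_sub.
exists u, v; split=> //.
(* An open interval inside [[a, b]] has its end points in [[a, b]]. *)
- rewrite leNgt; apply/negP => ua.
  have /uv_ab : `]u, v[%classic ((u + Num.min a v) / 2).
    by rewrite /= in_itv/=; case: (leP a v) => ?; lra.
  by rewrite /= in_itv/=; case: (leP a v) => ?; lra.
- rewrite leNgt; apply/negP => bv.
  have /uv_ab : `]u, v[%classic ((v + Num.max b u) / 2).
    by rewrite /= in_itv/=; case: (leP b u) => ?; lra.
  by rewrite /= in_itv/=; case: (leP b u) => ?; lra.
- apply: null_subset (restr i _ c'd'_cd c'd'_atom).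
  by move=> y [/uv_sub].
- apply: le_trans dc _; rewrite -mulrA ler_wpM2l//.
Qed.

End piecewise_map.

(** * Birkhoff sums *)

Section ergodic_sums.
Context {R : realType} {d : measure_display} {Omega : measurableType d}.
Variables (m : probability Omega R) (sigma : Omega -> Omega).
Hypothesis msigma : measurable_fun setT sigma.
Hypothesis sigma_pres : forall A, measurable A -> m (sigma @^-1` A) = m A.
Hypothesis sigma_erg : forall A, measurable A -> sigma @^-1` A = A ->
  m A = 0%E \/ m A = 1%E.
Implicit Type phi : Omega -> R.

(** The Birkhoff sums of [phi] along [sigma]. *)
Definition birkhoff_sum phi (n : nat) (w : Omega) : R :=
  \sum_(k < n) phi (iter k sigma w).

Lemma birkhoff_sumS phi n w :
  birkhoff_sum phi n.+1 w = phi w + birkhoff_sum phi n (sigma w).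
Proof.
rewrite /birkhoff_sum big_ord_recl; congr (_ + _); apply: eq_bigr => k _.
by rewrite lift0 iterSr.
Qed.

Lemma measurable_birkhoff_sum phi n : measurable_fun setT phi ->
  measurable_fun setT (birkhoff_sum phi n).
Proof.
move=> mphi; elim: n => [|n ih].
  have -> : birkhoff_sum phi 0 = cst 0.
    by apply/funext => w; rewrite /birkhoff_sum big_ord0.
  exact: measurable_cst.
have -> : birkhoff_sum phi n.+1 = phi \+ (birkhoff_sum phi n \o sigma).
  by apply/funext => w; rewrite birkhoff_sumS.
by apply: measurable_funD => //; exact: measurableT_comp.
Qed.

Lemma integral_comp_pres (h : Omega -> \bar R) :
  measurable_fun setT h -> m.-integrable setT h ->
  m.-integrable setT (h \o sigma) /\
  (\int[m]_w h (sigma w) = \int[m]_w h w)%E.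
Proof.
move=> mh ih.
have pfE A : measurable A -> pushforward m sigma A = m A by exact: sigma_pres.
have ihs : m.-integrable setT (h \o sigma).
  apply/integrableP; split; first exact: measurableT_comp.
  have /integrableP[_] := ih; apply: le_lt_trans.
  rewrite le_eqVlt; apply/orP; left; apply/eqP.
  rewrite -[RHS](@eq_measure_integral _ _ _ _ _ (pushforward m sigma)).
    by rewrite ge0_integral_pushforward//; exact: measurableT_comp.
  by move=> A mA _; exact: pfE.
split=> //.
rewrite -[RHS](@eq_measure_integral _ _ _ _ _ (pushforward m sigma)).
  by rewrite integral_pushforward.
by move=> A mA _; exact: pfE.
Qed.

(** The minimum of the Birkhoff sums of orders [0] to [n], in recursive form. *)
Fixpoint birkhoff_min phi (n : nat) (w : Omega) : R :=
  if n is n'.+1 then Num.min 0 (phi w + birkhoff_min phi n' (sigma w)) else 0.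

Lemma birkhoff_minP phi n w :
  exists2 k, birkhoff_min phi n w = birkhoff_sum phi k w & birkhoff_min phi n w <= 0.
Proof.
elim: n w => [|n ih] w /=; first by exists 0%N => //; rewrite /birkhoff_sum big_ord0.
have [k -> _] := ih (sigma w); case: (leP 0 (phi w + _)) => h.
  by exists 0%N => //; rewrite /birkhoff_sum big_ord0.
by exists k.+1; [rewrite birkhoff_sumS|exact: ltW].
Qed.

Lemma measurable_birkhoff_min phi n : measurable_fun setT phi ->
  measurable_fun setT (birkhoff_min phi n).
Proof.
move=> mphi; elim: n => [|n ih] /=; first exact: measurable_cst.
apply: measurable_minr => //.
by apply: measurable_funD => //; exact: measurableT_comp.
Qed.

Lemma birkhoff_min_step phi (K : R) n w : 0 <= K -> (forall w, - K <= phi w) ->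
  0 <= birkhoff_min phi n w - birkhoff_min phi n.+1 w <= K.
Proof.
move=> K0 phiK; elim: n w => [|n ih] w.
  by rewrite /= addr0 sub0r oppr_ge0 ge_min lexx/= lerNl le_min phiK oppr_le0 K0.
have /andP[h0 hK] := ih (sigma w).
rewrite [birkhoff_min phi n.+2 w]/= [birkhoff_min phi n.+1 w]/=.
move: h0 hK => /=; set u := birkhoff_min phi n (sigma w).
set v := Num.min 0 (phi (sigma w) + _) => h0 hK.
by case: (leP 0 (phi w + u)) => h1; case: (leP 0 (phi w + v)) => h2; lra.
Qed.

(** A function whose Birkhoff sums are bounded below almost everywhere has a
    nonnegative mean: [birkhoff_min phi n] converges, so that its increments,
    which are bounded, have integrals that tend to [0]; and these integrals are
    at most the one of [phi]. *)
Lemma bounded_birkhoff_sum_mean phi (K : R) : measurable_fun setT phi ->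
  0 <= K -> (forall w, - K <= phi w) -> m.-integrable setT (EFin \o phi) ->
  {ae m, forall w, exists C : R, forall n, C <= birkhoff_sum phi n w} ->
  (0 <= \int[m]_w (phi w)%:E)%E.
Proof.
move=> mphi K0 phiK iphi bd.
have mh n := measurable_birkhoff_min n mphi.
have iK : m.-integrable setT (cst K%:E).
  exact: finite_measure_integrable_cst.
have ih n : m.-integrable setT (EFin \o birkhoff_min phi n).
  elim: n => [|n ih]; first exact: integrable0.
  have istep : m.-integrable setT
      (EFin \o (fun w => birkhoff_min phi n w - birkhoff_min phi n.+1 w)).
    apply: le_integrable iK => //.
      by apply/measurable_EFinP; exact: measurable_funB.
    move=> w _ /=; rewrite lee_fin.
    by have /andP[? ?] := birkhoff_min_step n w K0 phiK; rewrite !ger0_norm.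
  have := integrableB measurableT ih istep.
  apply: eq_integrable => // w _ /=; rewrite -EFinB; congr (_%:E); ring.
pose dn n w := (birkhoff_min phi n.+1 w - birkhoff_min phi n w)%:E.
have dn_le n : (\int[m]_w dn n w <= \int[m]_w (phi w)%:E)%E.
  have [ihs isE] := @integral_comp_pres (EFin \o birkhoff_min phi n)
     ltac:(exact/measurable_EFinP) (ih n).
  rewrite /dn; under eq_integral do rewrite EFinB.
  rewrite integralB//; try exact: ih.
  rewrite leeBlDr; last exact: integrable_fin_num (ih n).
  rewrite -[X in (_ + X)%E]isE -integralD//.
  apply: le_integral => //; [exact: ih|exact: integrableD|].
  by move=> w _ /=; rewrite -EFinD lee_fin ge_min lexx orbT.
have dn0 : (fun n => \int[m]_w dn n w)%E @ \oo --> (\int[m]_w (cst 0%E w))%E.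
  have [ | | | // | | ? ? cvg_int // ] := @dominated_convergence _ Omega R m setT measurableT
    dn (cst 0%E) (cst K%:E).
  - move=> n; apply/measurable_EFinP; exact: measurable_funB.
  - exact: measurable_cst.
  - apply: filterS bd => w [C SC] _.
    have hC n : C <= birkhoff_min phi n w by have [k -> _] := birkhoff_minP phi n w.
    have hcvg : cvgn (birkhoff_min phi ^~ w).
      apply: nonincreasing_is_cvgn; last by exists C => _ [n _ <-].
      apply/nonincreasing_seqP => n.
      by have /andP[+ _] := birkhoff_min_step n w K0 phiK; rewrite subr_ge0.
    apply: cvg_EFin; first exact: nearW.
    rewrite -[X in _ --> X](subrr (limn (birkhoff_min phi ^~ w))).
    apply: cvgB => //; move: hcvg; rewrite -(cvg_shiftS (birkhoff_min phi ^~ w)); exact.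
  - apply: aeW => w n _ /=; rewrite lee_fin -normrN opprB.
    by have /andP[? ?] := birkhoff_min_step n w K0 phiK; rewrite ger0_norm.
rewrite integral0 in dn0.
rewrite -(cvg_lim _ dn0)//; apply: lime_le; first by apply/cvg_ex; exists 0%E.
by apply: nearW => n; exact: dn_le.
Qed.

(** A function of negative mean has Birkhoff sums that are almost surely
    unbounded below. *)
Lemma birkhoff_sum_unbounded phi :
  measurable_fun setT phi -> m.-integrable setT (EFin \o phi) ->
  (\int[m]_w (phi w)%:E < 0)%E ->
  {ae m, forall w, forall C : R, exists n, birkhoff_sum phi n w < C}.
Proof.
move=> mphi iphi phi_neg.
pose trunc n w := Num.max (phi w) (- n%:R).
have mtrunc n : measurable_fun setT (trunc n) by exact: measurable_maxr.
have itrunc_le n w : `|trunc n w| <= `|phi w|.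
  rewrite /trunc; have n0 : 0 <= n%:R :> R by [].
  case: (leP (phi w) (- n%:R)) => // h.
  by rewrite normrN ger0_norm// ler0_norm; lra.
have itrunc n : m.-integrable setT (EFin \o trunc n).
  apply: le_integrable iphi => //; first exact/measurable_EFinP.
  by move=> w _; rewrite /= lee_fin itrunc_le.
(* The truncation from below at a low enough level still has negative mean. *)
have [n negn] : exists n, (\int[m]_w (trunc n w)%:E < 0)%E.
  apply: contrapT => /forallNP nonneg.
  have : (fun n => \int[m]_w (trunc n w)%:E)%E @ \oo --> (\int[m]_w (phi w)%:E)%E.
    have [ | | | | | ? ? cvg_int // ] := @dominated_convergence _ Omega R m setT measurableT
      (fun n w => (trunc n w)%:E) (EFin \o phi) (fun w => `|phi w|%:E).
    - by move=> n; exact/measurable_EFinP.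
    - exact/measurable_EFinP.
    - apply: aeW => w _; apply: cvg_near_cst.
      exists (Num.truncn `|phi w|).+1 => // k /= nk; rewrite /trunc max_l//.
      rewrite lerNl; apply: le_trans (ler_norm _) _; rewrite normrN.
      apply: ltW; apply: lt_le_trans (truncnS_gt _) _; by rewrite ler_nat.
    - exact: integrable_norm.
    - by apply: aeW => w n _; rewrite lee_fin itrunc_le.
  move=> cv; move: phi_neg; rewrite -(cvg_lim (@ereal_hausdorff _) cv).
  apply/negP; rewrite -leNgt; apply: lime_ge; first by apply/cvg_ex; eexists; exact: cv.
  by apply: nearW => n; have /negP := nonneg n; rewrite -leNgt.
(* The invariant set where the sums of the truncation are bounded below. *)
pose B := [set w | exists k : nat, forall j, - k%:R <= birkhoff_sum (trunc n) j w].
have mB : measurable B.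
  have -> : B = \bigcup_k \bigcap_j
      (setT `&` birkhoff_sum (trunc n) j @^-1` `[- k%:R, +oo[%classic).
    apply/seteqP; split=> [w [k kP]|w [k _ kP]].
      by exists k => // j _; split=> //=; rewrite in_itv/= kP.
    by exists k => j; have [_ /=] := kP j I; rewrite in_itv/= andbT.
  apply: bigcup_measurable => k _; apply: bigcap_measurable => // j _.
  exact: (measurable_birkhoff_sum j (mtrunc n)).
have BE w : B w <-> exists C : R, forall j, C <= birkhoff_sum (trunc n) j w.
  split=> [[k kP]|[C CP]]; first by exists (- k%:R).
  exists (Num.truncn `|C|).+1 => j; apply: le_trans (CP j).
  rewrite lerNl; apply: le_trans (ler_norm _) _; rewrite normrN.
  exact/ltW/truncnS_gt.
have Binv : sigma @^-1` B = B.
  apply/seteqP; split=> w /BE[C CP]; apply/BE.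
    exists (Num.min 0 (trunc n w + C)) => -[|j].
      by rewrite /birkhoff_sum big_ord0 ge_min lexx.
    by rewrite birkhoff_sumS ge_min lerD2l CP orbT.
  exists (C - trunc n w) => j.
  by have := CP j.+1; rewrite birkhoff_sumS; lra.
have [B0|B1] := sigma_erg mB Binv.
  exists B; split=> // w /= /existsNP[C /forallNP CP]; apply/BE; exists C => j.
  have : C <= birkhoff_sum phi j w by rewrite leNgt; apply/negP; exact: CP.
  move=> /le_trans; apply; apply: ler_sum => k _.
  by rewrite /trunc le_max lexx.
exfalso; move: negn; apply/negP; rewrite -leNgt.
apply: (@bounded_birkhoff_sum_mean _ n%:R) => //.
  by move=> w; rewrite /trunc le_max lexx orbT.
exists (~` B); split; first exact: measurableC.
  by rewrite probability_setC// B1 subee.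
by move=> w /= nC Bw; apply: nC; exact/BE.
Qed.
End ergodic_sums.

(** * The contraction coefficient *)

Section index_functions.
Context {R : realType} {d : measure_display} {Omega : measurableType d}.
Variables (m : probability Omega R) (sigma : Omega -> Omega) (idx : Omega -> nat).
Hypothesis idx_meas : measurable_index idx.

Lemma measurable_index_set (P : nat -> Prop) : measurable [set w | P (idx w)].
Proof.
rewrite (_ : [set w | P (idx w)] = \bigcup_(j in P) [set w | idx w = j]).
  by apply: bigcup_measurable => j _; exact: idx_meas.
by apply/seteqP; split=> [w Pw|w [j Pj /= ->//]]; exists (idx w).
Qed.

Lemma measurable_index_fun d' (T' : measurableType d') (f : nat -> T') :
  measurable_fun setT (f \o idx).
Proof.
by move=> _ Y mY; rewrite setTI; exact: (measurable_index_set (f @^-1` Y)).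
Qed.

Lemma integrable_index_fine (X : nat -> \bar R) :
  m.-integrable setT (X \o idx) ->
  m.-integrable setT (fun w => `|fine (X (idx w))|%:E).
Proof.
move=> iX; apply: le_integrable iX => //.
  exact: (@measurable_index_fun _ _ (fun j => `|fine (X j)|%:E)).
move=> w _; rewrite /= normr_id; case: (X (idx w)) => [x||] //=; rewrite normr0 leey//.
Qed.

Lemma ae_index_iter (P : nat -> Prop) : measurable_fun setT sigma ->
  (forall A, measurable A -> m (sigma @^-1` A) = m A) ->
  {ae m, forall w, P (idx w)} ->
  {ae m, forall w, forall n, P (idx (iter n sigma w))}.
Proof.
move=> msigma pres Pae.
have mNP : measurable [set w | ~ P (idx w)].
  exact: (measurable_index_set (fun j => ~ P j)).
have NP0 : m [set w | ~ P (idx w)] = 0%E by apply/(negligibleP _ mNP).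
apply/ae_foralln => n.
have [mn n0] : measurable [set w | ~ P (idx (iter n sigma w))] /\
    m [set w | ~ P (idx (iter n sigma w))] = 0%E.
  elim: n => [//|n [mn n0]].
  have -> : [set w | ~ P (idx (iter n.+1 sigma w))] =
      sigma @^-1` [set w | ~ P (idx (iter n sigma w))].
    by apply/seteqP; split=> w; rewrite /= -iterSr.
  by rewrite pres//; split=> //; rewrite -[X in measurable X]setTI; exact: msigma.
by exists [set w | ~ P (idx (iter n sigma w))]; split.
Qed.

End index_functions.

Section contraction.
Context {R : realType}.
Variables (a b : R) (T : R -> R) (s : seq R).
Hypothesis ab : a < b.
Hypothesis pm : piecewise_monotone_map a b T s.
Notation V := (var a b (weight T)).
Notation M := (norm_infty a b (weight T)).
Notation e := (Einf a b (weight T)).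

(** The finiteness that integrability provides at almost every point: the
    essential bounds of the weight are then positive real numbers. *)
Definition regular_map : Prop :=
  [/\ lne M \is a fin_num, lne e \is a fin_num & (V / M)%E \is a fin_num].

(** The logarithm of the contraction coefficient as a real number, with the
    default value [0] for the maps that are not regular. *)
Definition log_coef : R :=
  if `[< regular_map >] then fine (lne (contraction_coef a b T s)) else 0.

Lemma var_ge0 (f : R -> R) : (0 <= var a b f)%E.
Proof.
apply: le_ereal_inf_tmp => _ [h _ <-]; exact: total_variation_ge0 (ltW ab).
Qed.

Lemma lne_fin_num (x : \bar R) : lne x \is a fin_num ->
  exists2 r : R, 0 < r & x = r%:E.
Proof.
case: x => [r||] //=; case: ifPn => //; rewrite -ltNge => r0 _; by exists r.
Qed.

Lemma nb_full_le_size : (nb_full a b T s <= size s)%N.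
Proof. by rewrite -[leqRHS]card_ord max_card. Qed.

Lemma xi_le_size : (xi a b T s <= size s)%N.
Proof. by apply/bigmax_leqP => A _; rewrite -[leqRHS]card_ord max_card. Qed.

Lemma regular_coef : regular_map ->
  exists gmin gmax v : R, [/\ 0 < gmin, 0 < gmax & 0 <= v] /\
    [/\ e = gmin%:E, M = gmax%:E, (V / M)%E = v%:E &
     contraction_coef a b T s =
       ((3 + 3 * v) * (1 + 2 * xi a b T s)%:R * (gmax / gmin)
         / (nb_full a b T s)%:R)%:E].
Proof.
move=> [/lne_fin_num[gmax gmax0 ME] /lne_fin_num[gmin gmin0 eE] VM].
exists gmin, gmax, (fine (V / M)); split; last split=> //; last first.
- rewrite /contraction_coef -[in LHS](fineK VM) ME eE !inver.
  rewrite (negbTE (lt0r_neq0 gmin0)) pnatr_eq0 eqn0Ngt (nb_full_gt0 pm) /=.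
  by [].
- by rewrite fineK.
split=> //; apply: fine_ge0; apply: mule_ge0; first exact: var_ge0.
by rewrite inve_ge0 ME lee_fin ltW.
Qed.

Lemma regular_ae_bounds gmin gmax : e = gmin%:E -> M = gmax%:E ->
  ae_ge `[a, b]%classic (weight T) gmin /\
  (@lebesgue_measure R).-negligible
    (`[a, b]%classic `&` [set x | gmax < weight T x]).
Proof.
move=> eE ME; split.
  have /ae_leb_on := ess_inf_le (leb_on a b) (EFin \o weight T).
  apply: null_subset => x [abx /= wx]; split=> //=; apply/negP.
  by rewrite -ltNge -/(Einf a b (weight T)) eE lte_fin.
have /ae_leb_on := ess_sup_ge (leb_on a b) (EFin \o (fun x => `|weight T x|)).
apply: null_subset => x [abx /= wx]; split=> //=; apply/negP.
rewrite -ltNge [X in (X < _)%E](ME : ess_sup _ _ = _) lte_fin.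
by rewrite ger0_norm// weight_ge0.
Qed.

(** The contraction coefficient is at least the factor by which an interval may
    shrink; this uses the bound on the number of full atoms. *)
Lemma regular_growth gmin gmax : regular_map -> e = gmin%:E -> M = gmax%:E ->
  (xi a b T s + 2)%:R * (3 / 2 * gmax) <= expR log_coef.
Proof.
move=> reg eE ME.
have [gmin' [gmax' [v [[gmin0 gmax0 v0] [eE' ME' _ cE]]]]] := regular_coef reg.
have [? ?] : gmin' = gmin /\ gmax' = gmax.
  by move: eE' ME'; rewrite eE ME => -[->] [->].
subst gmin' gmax'; have [wmin _] := regular_ae_bounds eE ME.
have eb := nb_full_bound ab pm gmin0 wmin.
have b0 : 0 < (nb_full a b T s)%:R :> R by rewrite ltr0n (nb_full_gt0 pm).
have c0 : 0 < (3 + 3 * v) * (1 + 2 * xi a b T s)%:R * (gmax / gmin)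
         / (nb_full a b T s)%:R.
  by rewrite !(mulr_gt0, invr_gt0)// ?ltr0n//; lra.
rewrite /log_coef asboolT// cE lne_EFin//= lnK ?posrE//.
rewrite [leRHS](_ : _ = (3 + 3 * v) * (1 + 2 * xi a b T s)%:R * gmax /
   (gmin * (nb_full a b T s)%:R)); last first.
  by field; rewrite !gt_eqF.
rewrite ler_pdivlMr ?mulr_gt0//.
have x0 : 0 <= (xi a b T s)%:R :> R by [].
rewrite natrD natrD natrM; set x := (xi a b T s)%:R in x0 *.
apply: (@le_trans _ _ ((x + 2) * (3 / 2 * gmax))).
  by rewrite ler_piMr// !mulr_ge0 ?(ltW gmax0)//; lra.
apply: (@le_trans _ _ (3 * (1 + 2 * x) * gmax)).
  by rewrite mulrA ler_wpM2r ?(ltW gmax0)//; lra.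
rewrite ler_wpM2r ?(ltW gmax0)// ler_wpM2r//; lra.
Qed.

(** The terms on the right are those whose integrability strong contraction
    provides; the numbers of contiguous non-full atoms and of full atoms are at
    most the number of atoms. *)
Lemma log_coef_le : `|log_coef| <=
  2 + ln 3 + 2 * `|fine (lne (size s)%:R%:E)| + `|fine (lne M)| + `|fine (lne e)|
  + 3 * `|fine (V / M)%E|.
Proof.
have ln3 : 0 <= ln 3 :> R by rewrite ln_ge0//; lra.
have [reg|reg] := pselect regular_map; last first.
  by rewrite /log_coef asboolF// normr0 !addr_ge0// mulr_ge0.
have [gmin [gmax [v [[gmin0 gmax0 v0] [eE ME VM cE]]]]] := regular_coef reg.
have b0 : 0 < (nb_full a b T s)%:R :> R by rewrite ltr0n (nb_full_gt0 pm).
have x0 : 0 < (1 + 2 * xi a b T s)%:R :> R by rewrite ltr0n.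
have v30 : 0 < 3 + 3 * v by lra.
have s1 : 1 <= (size s)%:R :> R.
  by rewrite ler1n (leq_trans (nb_full_gt0 pm) nb_full_le_size).
rewrite /log_coef asboolT// cE VM eE ME !lne_EFin ?(lt_le_trans ltr01 s1)//=; last first.
  by rewrite !(mulr_gt0, invr_gt0).
rewrite !lnM ?posrE ?(mulr_gt0, invr_gt0)// !lnV ?posrE//.
have lnb0 : 0 <= ln (nb_full a b T s)%:R :> R by rewrite ln_ge0// ler1n (nb_full_gt0 pm).
have lnb : ln (nb_full a b T s)%:R <= ln (size s)%:R :> R.
  by rewrite ler_ln ?posrE ?(lt_le_trans ltr01 s1)// ler_nat nb_full_le_size.
have lnx0 : 0 <= ln (1 + 2 * xi a b T s)%:R :> R by rewrite ln_ge0// ler1n.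
have lnx : ln (1 + 2 * xi a b T s)%:R <= ln 3 + ln (size s)%:R :> R.
  rewrite -lnM ?posrE ?(lt_le_trans ltr01 s1)//.
  rewrite ler_ln ?posrE ?mulr_gt0 ?(lt_le_trans ltr01 s1)//.
  rewrite natrD natrM; have := xi_le_size; rewrite -(ler_nat R); lra.
have lnv0 : 0 <= ln (3 + 3 * v) by rewrite ln_ge0//; lra.
have lnv : ln (3 + 3 * v) <= 2 + 3 * v.
  have -> : 3 + 3 * v = 1 + (2 + 3 * v) by ring.
  by apply: le_ln1Dx; lra.
rewrite (ger0_norm v0) (ger0_norm (le_trans lnb0 lnb)).
have := ler_norm (ln gmax); have := ler_norm (- ln gmax); rewrite normrN.
have := ler_norm (ln gmin); have := ler_norm (- ln gmin); rewrite normrN.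
by rewrite ler_norml; lra.
Qed.

End contraction.

(** * Covering along an orbit *)

Section covering_orbit.
Context {R : realType} {d : measure_display} {Omega : measurableType d}.
Variables (sigma : Omega -> Omega) (idx : Omega -> nat).
Variables (a b : R) (T : nat -> R -> R) (s : nat -> seq R).
Hypothesis ab : a < b.
Hypothesis Tmaps : forall j, piecewise_monotone_map a b (T j) (s j).

Lemma transfer_iter_ge0 n w (f : R -> R) : (forall x, 0 <= f x) ->
  forall y, 0 <= transfer_iter sigma idx a b T s n w f y.
Proof. by move=> f0; elim: n => [//|n ih]; exact: transfer_ge0. Qed.

(** If the interval never covered, the lengths of the intervals [J_n] would
    outgrow [b - a]. *)
Lemma orbit_covers (w : Omega) (c e : R) :
  (forall n, regular_map a b (T (idx (iter n sigma w)))) ->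
  (forall C : R, exists n, birkhoff_sum sigma
     (fun w => log_coef a b (T (idx w)) (s (idx w))) n w < C) ->
  a <= c -> c < e -> e <= b ->
  exists2 M : nat, (0 < M)%N &
    (0 < Einf a b (transfer_iter sigma idx a b T s M w \1_(`]c, e[%classic)))%E.
Proof.
move=> reg unbounded ac ce eb.
set phi := fun w => _ in unbounded.
pose L n := transfer_iter sigma idx a b T s n w \1_(`]c, e[%classic).
have L0 n x : 0 <= L n x by apply: transfer_iter_ge0 => y; rewrite indicE.
suff [n [r r0 Lr]] : exists n, exists2 r, 0 < r & ae_ge `[a, b]%classic (L n.+1) r.
  exists n.+1 => //; apply: (@lt_le_trans _ _ r%:E); first by rewrite lte_fin.
  apply/ess_infP/ae_leb_on; apply: null_subset Lr => x [abx] /=.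
  by move=> /negP; rewrite -ltNge lte_fin.
apply: contrapT => /forallNP nocover.
have grow n : exists c' e' r : R, [/\ a <= c', c' < e' & e' <= b] /\
    [/\ 0 < r, ae_ge `]c', e'[%classic (L n) r &
        e - c <= expR (birkhoff_sum sigma phi n w) * (e' - c')].
  elim: n => [|n [c' [e' [r [[ac' ce' eb'] [r0 Lr len]]]]]].
    exists c, e, 1; split=> //; split=> //.
      exists set0; split=> //.
      by move=> x [cex]; rewrite /L /= indicE mem_set// ltxx.
    by rewrite /birkhoff_sum big_ord0 expR0 mul1r.
  set v := iter n sigma w; have regv : regular_map a b (T (idx v)) by exact: reg.
  have [gmin [gmax [_ [[gmin0 gmax0 _] [eE ME _ _]]]]] :=
    regular_coef (s := s (idx v)) ab (Tmaps (idx v)) regv.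
  have [wmin wmax] := regular_ae_bounds eE ME.
  have rg0 : 0 < r * gmin by rewrite mulr_gt0.
  have [cov|[c2 [e2 [ac2 ce2 eb2 Lr2 len2]]]] :=
    cover_or_grow (Tmaps (idx v)) gmin0 gmax0 wmin wmax ac' ce' eb' (L0 n) r0 Lr.
    by case: (nocover n); exists (r * gmin).
  exists c2, e2, (r * gmin); split=> //; split=> //.
  apply: le_trans len _; rewrite /birkhoff_sum big_ord_recr/= expRD -mulrA.
  rewrite ler_wpM2l ?expR_ge0//; apply: le_trans len2 _.
  rewrite ler_wpM2r ?subr_ge0 ?(ltW ce2)//.
  exact: (regular_growth ab (Tmaps (idx v)) regv eE ME).
have [n small] := unbounded (ln ((e - c) / (b - a))).
have [c' [e' [r [[ac' ce' eb'] [_ _]]]]] := grow n.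
apply/negP; rewrite -ltNge.
have q0 : 0 < (e - c) / (b - a) by rewrite divr_gt0 ?subr_gt0.
apply: (@le_lt_trans _ _ (expR (birkhoff_sum sigma phi n w) * (b - a))).
  by rewrite ler_wpM2l ?expR_ge0//; lra.
by rewrite -ltr_pdivlMr ?subr_gt0// -[ltRHS]lnK ?posrE// ltr_expR.
Qed.

End covering_orbit.

Section log_coef_integral.
Context {R : realType} {d : measure_display} {Omega : measurableType d}.
Variables (m : probability Omega R) (idx : Omega -> nat).
Variables (a b : R) (T : nat -> R -> R) (s : nat -> seq R).
Hypothesis idx_meas : measurable_index idx.
Hypothesis ab : a < b.
Hypothesis Tmaps : forall j, piecewise_monotone_map a b (T j) (s j).
Hypothesis contracting : strongly_contracting m idx a b T s.

Notation phi := (fun w => log_coef a b (T (idx w)) (s (idx w))).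

Lemma ae_regular_map : {ae m, forall w, regular_map a b (T (idx w))}.
Proof.
have [_ iM ie iV _] := contracting.
have := integrable_ae measurableT iM; have := integrable_ae measurableT ie.
have := integrable_ae measurableT iV.
apply: filterS3 => w V_fin e_fin M_fin.
by split; [exact: M_fin|exact: e_fin|exact: V_fin].
Qed.

Lemma integrable_log_coef : m.-integrable setT (EFin \o phi).
Proof.
have [iZ iM ie iV _] := contracting.
pose G j : R := 2 + ln 3 + 2 * `|fine (lne (size (s j))%:R%:E)|
  + `|fine (lne (norm_infty a b (weight (T j))))| + `|fine (lne (Einf a b (weight (T j))))|
  + 3 * `|fine (var a b (weight (T j)) / norm_infty a b (weight (T j)))%E|.
have iG : m.-integrable setT (EFin \o (G \o idx)).
  have fs := @integrable_index_fine _ _ _ m idx idx_meas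
    (fun j => lne (size (s j))%:R%:E) iZ.
  have fM := @integrable_index_fine _ _ _ m idx idx_meas
    (fun j => lne (norm_infty a b (weight (T j)))) iM.
  have fe := @integrable_index_fine _ _ _ m idx idx_meas
    (fun j => lne (Einf a b (weight (T j)))) ie.
  have fV := @integrable_index_fine _ _ _ m idx idx_meas
    (fun j => var a b (weight (T j)) / norm_infty a b (weight (T j)))%E iV.
  have fc : m.-integrable setT (cst (2 + ln 3)%:E).
    exact: finite_measure_integrable_cst.
  have := integrableD measurableT (integrableD measurableT (integrableD measurableT
    (integrableD measurableT fc (integrableZl measurableT 2 fs)) fM) fe)
    (integrableZl measurableT 3 fV).
  by [].
apply: le_integrable iG => //.
  exact: (@measurable_index_fun _ _ _ idx_meas _ _ (fun j => (log_coef a b (T j) (s j))%:E)).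
move=> w _; rewrite /= lee_fin; apply: le_trans (log_coef_le ab (Tmaps (idx w))) _.
exact: ler_norm.
Qed.

Lemma integral_log_coef_lt0 : (\int[m]_w (phi w)%:E < 0)%E.
Proof.
have [_ _ _ _] := contracting; apply: le_lt_trans.
rewrite le_eqVlt; apply/orP; left; apply/eqP.
apply: ae_eq_integral => //.
- exact: (@measurable_index_fun _ _ _ idx_meas _ _ (fun j => (log_coef a b (T j) (s j))%:E)).
- exact: (@measurable_index_fun _ _ _ idx_meas _ _
    (fun j => lne (contraction_coef a b (T j) (s j)))).
apply: filterS ae_regular_map => w reg _; rewrite /log_coef asboolT// fineK//.
have [gmin [gmax [v [[gmin0 gmax0 v0] [_ _ _ ->]]]]] :=
  regular_coef ab (Tmaps (idx w)) reg.
rewrite lne_EFin// !(mulr_gt0, invr_gt0)// ?ltr0n ?(nb_full_gt0 (Tmaps _))//; lra.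
Qed.

End log_coef_integral.

Theorem lemma7p9 (R : realType) (d : measure_display)
    (Omega : measurableType d) (m : probability Omega R)
    (E : metricType R) (iota : Omega -> E)
    (sigma tau : Omega -> Omega) (idx : Omega -> nat)
    (a b : R) (T : nat -> R -> R) (s : nat -> seq R)
    (Esep : separable E) (Ecomplete : complete_space E)
    (OmegaE : borel_subset iota) (mborel : complete_borel_measure m iota)
    (sigma_erg : invertible_ergodic m sigma tau)
    (sigma_homeo : homeomorphism iota sigma tau)
    (idx_meas : measurable_index idx)
    (ab : a < b)
    (Tmaps : forall j, piecewise_monotone_map a b (T j) (s j))
    (contracting : strongly_contracting m idx a b T s) :
  covering m sigma idx a b T s.
Proof.
have [_ _ msigma _ pres erg] := sigma_erg.
have mphi := @measurable_index_fun _ _ idx idx_meas _ _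
  (fun j => log_coef a b (T j) (s j)).
have reg := ae_index_iter idx_meas (P := fun j => regular_map a b (T j))
  msigma pres (ae_regular_map contracting).
have unbounded := birkhoff_sum_unbounded msigma pres erg mphi
  (integrable_log_coef idx_meas ab Tmaps contracting)
  (integral_log_coef_lt0 idx_meas ab Tmaps contracting).
apply: filterS2 reg unbounded => w reg_w unbounded_w c e ac ce eb.
exact: orbit_covers.
Qed.
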